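(* Let $\beta>-1$ be a fixed real number. The approximation operator relative to the enriched finite element $\mathcal{E}_\beta$, $$\Pi^{\mathrm{enr}}_{2,\mathcal{E}_\beta}:C(T)\to\mathbb{P}_2(T),\qquad f\mapsto\sum_{j=1}^{3}\left(\mathcal{I}^{\mathrm{CR}}_j(f)\,\tau_j+\mathcal{G}^{\mathrm{enr}}_{j,\beta}(f)\,\rho_j\right),$$ reproduces all polynomials of $\mathbb{P}_2(T)$ (i.e. $\Pi^{\mathrm{enr}}_{2,\mathcal{E}_\beta}[p]=p$ for every $p\in\mathbb{P}_2(T)$) and satisfies, for every $f\in C(T)$, $$\mathcal{I}^{\mathrm{CR}}_j\left(\Pi^{\mathrm{enr}}_{2,\mathcal{E}_\beta}[f]\right)=\mathcal{I}^{\mathrm{CR}}_j(f),\qquad \mathcal{G}^{\mathrm{enr}}_{j,\beta}\left(\Pi^{\mathrm{enr}}_{2,\mathcal{E}_\beta}[f]\right)=\mathcal{G}^{\mathrm{enr}}_{j,\beta}(f),\qquad j=1,2,3.$$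
   Context: Let $T\subset\mathbb{R}^2$ be a nondegenerate triangle with vertices $\boldsymbol{v}_1,\boldsymbol{v}_2,\boldsymbol{v}_3$, with the convention $\boldsymbol{v}_4=\boldsymbol{v}_1$, $\boldsymbol{v}_5=\boldsymbol{v}_2$, and let $\boldsymbol{m}^\star=\frac{\boldsymbol{v}_1+\boldsymbol{v}_2+\boldsymbol{v}_3}{3}$. $C(T)$ is the space of continuous real-valued functions on $T$ and $\mathbb{P}_2(T)$ is the space of real bivariate polynomials of total degree at most $2$, regarded as functions on $T$. For $j=1,2,3$ define $$\mathcal{I}^{\mathrm{CR}}_j(f)=\int_0^1 f\left(t\boldsymbol{v}_{j+1}+(1-t)\boldsymbol{v}_{j+2}\right)dt,\qquad \mathcal{G}^{\mathrm{enr}}_{j,\beta}(f)=\int_0^1 w_\beta(t)\, f\left(t\boldsymbol{v}_j+(1-t)\boldsymbol{m}^\star\right)dt,\qquad w_\beta(t)=t^\beta(1-t)^\beta.$$ The triple $\mathcal{E}_\beta=(T,\mathbb{P}_2(T),\{\mathcal{I}^{\mathrm{CR}}_j,\mathcal{G}^{\mathrm{enr}}_{j,\beta}: j=1,2,3\})$ is a finite element (the six functionals are unisolvent on $\mathbb{P}_2(T)$). The basis functions associated to $\mathcal{E}_\beta$ are the basis $\{\tau_i,\rho_i: i=1,2,3\}$ of $\mathbb{P}_2(T)$ satisfying, for $i,j=1,2,3$, $$\mathcal{I}^{\mathrm{CR}}_j(\tau_i)=\delta_{ij},\quad \mathcal{G}^{\mathrm{enr}}_{j,\beta}(\tau_i)=0,\qquad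 \mathcal{I}^{\mathrm{CR}}_j(\rho_i)=0,\quad \mathcal{G}^{\mathrm{enr}}_{j,\beta}(\rho_i)=\delta_{ij}.$$ *)

(* Defs.v *)
From HB Require Import structures.
From mathcomp Require Import all_boot all_order all_algebra.
From mathcomp Require Import all_classical all_reals all_analysis.
(* The notations of mpoly clash with those of mathcomp-analysis. *)
From mathcomp Require mpoly.
Import -(notations) mpoly.

Set Implicit Arguments.
Unset Strict Implicit.
Unset Printing Implicit Defensive.

Import Order.TTheory GRing.Theory Num.Theory.
Import numFieldNormedType.Exports.

Local Open Scope classical_set_scope.
Local Open Scope ring_scope.

(* Functions on the triangle are represented by total functions on the plane;
   their values outside the triangle are never used: integrals are taken along
   segments of the triangle and equalities are only asserted on the triangle.
   The three indices live in 'I_3, seen as the additive group Z/3, so that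
   [j + 1] and [j + 2%:R] wrap around as in v_4 = v_1, v_5 = v_2. *)

Section EnrichedElement.
Variable R : realType.
Local Notation plane := 'rV[R]_2.
Local Notation mu := (@lebesgue_measure R).

Section Triangle.
Variable v : 'I_3 -> plane.

Definition nondegenerate_triangle : bool :=
  row_free (col_mx (v 1 - v 0) (v 2%:R - v 0)).

Definition triangle : set plane :=
  [set x | exists a : 'I_3 -> R,
    [/\ forall i, 0 <= a i, \sum_i a i = 1 & x = \sum_i a i *: v i]].

Definition barycenter : plane := 3%:R^-1 *: \sum_i v i.

Definition CT : set (plane -> R) := [set f | {within triangle, continuous f}].

(* [mpoly.msize] is one plus the total degree (and 0 for the zero
   polynomial). *)
Definition P2 : set (plane -> R) :=
  [set p | exists P : mpoly 2 R,
    (mpoly.msize P <= 3)%N /\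
    forall x, triangle x -> p x = meval (fun i => x 0 i) P].

Definition is_basis_of_P2 (I : finType) (b : I -> plane -> R) : Prop :=
  [/\ forall i, P2 (b i),
      forall a : I -> R,
        (forall x, triangle x -> \sum_i a i * b i x = 0) -> forall i, a i = 0
    & forall p, P2 p -> exists a : I -> R,
        forall x, triangle x -> p x = \sum_i a i * b i x].

Definition ICR (j : 'I_3) (f : plane -> R) : R :=
  \int[mu]_(t in `[0, 1]) f (t *: v (j + 1) + (1 - t) *: v (j + 2%:R)).

Definition weight (beta t : R) : R := t `^ beta * (1 - t) `^ beta.

(* For beta < 0 the weight is unbounded, and this Lebesgue integral is the
   improper integral; [weight] at t = 0 and t = 1 is then a junk value, on a
   null set. *)
Definition Genr (beta : R) (j : 'I_3) (f : plane -> R) : R :=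
  \int[mu]_(t in `[0, 1])
    (weight beta t * f (t *: v j + (1 - t) *: barycenter)).

Definition basis_functions (beta : R) (tau rho : 'I_3 -> plane -> R) : Prop :=
  [/\ is_basis_of_P2 (fun k : 'I_3 + 'I_3 =>
        match k with inl i => tau i | inr i => rho i end),
      forall i j, ICR j (tau i) = (i == j)%:R,
      forall i j, Genr beta j (tau i) = 0,
      forall i j, ICR j (rho i) = 0
    & forall i j, Genr beta j (rho i) = (i == j)%:R].

Definition Pi_enr (beta : R) (tau rho : 'I_3 -> plane -> R) (f : plane -> R) :
    plane -> R :=
  fun x => \sum_j (ICR j f * tau j x + Genr beta j f * rho j x).

End Triangle.
End EnrichedElement.

(* Main.v *)
(* On a triangle, both families of functionals are weighted integrals of f over
   a segment contained in the triangle, hence linear on P_2, provided that the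
   weight is integrable.  Linearity and duality show that the coefficients of
   p in the basis are I_j(p) and G_j(p), which gives the reproduction property,
   and that Pi f has the same functional values as f.  The analytic point is
   the integrability of w_beta when -1 < beta < 0: w_beta is dominated by
   t^beta + (1 - t)^beta, whose primitive
   (t^(beta+1) - (1 - t)^(beta+1)) / (beta + 1) is bounded on ]0, 1[. *)

Require Import Defs.
From mathcomp Require Import all_boot all_order all_algebra.
From mathcomp Require Import all_classical all_reals all_analysis.
From mathcomp Require mpoly.
Import -(notations) mpoly.
From mathcomp Require Import lra measurable_realfun.

Import Order.TTheory GRing.Theory Num.Theory.
Import numFieldNormedType.Exports.

Local Open Scope classical_set_scope.
Local Open Scope ring_scope.

(** * Integrability of the weight *)

Lemma itvoo_bigcup_itvcc (R : realType) (a b : R) :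
  `]a, b[%classic = \bigcup_n `[a + n.+1%:R^-1, b - n.+1%:R^-1]%classic.
Proof.
apply/seteqP; split => x /=; rewrite ?in_itv/=.
  move=> /andP[ax xb].
  have e0 : 0 < Num.min (x - a) (b - x) by rewrite lt_min !subr_gt0 ax xb.
  have [n _ /(_ n (leqnn n))/=] := near_infty_natSinv_lt (PosNum e0).
  rewrite lt_min ltrBrDr ltrBrDl => /andP[na nb].
  by exists n => //=; rewrite in_itv/= (addrC a) lerBrDr ltW// ltW.
move=> [n _ /=]; rewrite in_itv/= => /andP[ax xb].
have n0 : 0 < n.+1%:R^-1 :> R by rewrite invr_gt0.
by rewrite (lt_le_trans _ ax) ?ltrDl// (le_lt_trans xb)// gtrDl oppr_lt0.
Qed.

(** On each compact subinterval the fundamental theorem of calculus bounds the integral of [f] by an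
    oscillation of [F]. Monotone convergence along an exhaustion of []a, b[] carries the bound over
    to the whole interval. *)
Lemma ge0_bounded_primitive_integrable (R : realType) (f F : R -> R)
    (a b M : R) :
  {in `]a, b[, forall x, 0 <= f x} ->
  {in `]a, b[, continuous f} ->
  {in `]a, b[, forall x : R, is_derive x (1 : R) F (f x)} ->
  {in `]a, b[, forall x, `|F x| <= M} ->
  (@lebesgue_measure R).-integrable `]a, b[ (EFin \o f).
Proof.
move=> f0 cf dF FM.
have mf : measurable_fun `]a, b[ (EFin \o f).
  apply/measurable_EFinP; apply: open_continuous_measurable_fun => // x.
  by rewrite inE; exact: cf.
apply/integrableP; split => //.
under eq_integral => x xab do [rewrite inE in xab; rewrite /= ger0_norm ?f0//].
pose E n := `[a + n.+1%:R^-1, b - n.+1%:R^-1]%classic : set R.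
have EU : `]a, b[%classic = \bigcup_n E n by exact: itvoo_bigcup_itvcc.
have Eab n : E n `<=` `]a, b[ by rewrite EU => x Enx; exists n.
have intE : (\int[@lebesgue_measure R]_(x in E n) (f x)%:E @[n --> \oo] -->
    \int[@lebesgue_measure R]_(x in \bigcup_n E n) (f x)%:E)%E.
  apply: ge0_nondecreasing_set_cvg_integral.
  - move=> m n mn; apply/subsetPset => x; rewrite /E/= !in_itv/=.
    move=> /andP[ax xb].
    have : n.+1%:R^-1 <= m.+1%:R^-1 :> R by rewrite lef_pV2 ?posrE// ler_nat.
    move=> le_mn; rewrite (le_trans _ ax) ?lerD2l// (le_trans xb)//.
    by rewrite lerD2l lerN2.
  - by move=> n; exact: measurable_itv.
  - by move=> n; exact: measurable_funS mf.
  - by move=> n x /Eab xab; rewrite lee_fin f0.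
rewrite -EU in intE.
(* The absolute value keeps the bound nonnegative when []a, b[] is empty, a case in which [M] is
   unconstrained. *)
apply: (@le_lt_trans _ _ (2 * `|M|)%:E); last by rewrite ltry.
apply: (cvge_le _ intE).
apply: nearW => n; rewrite /E.
(* For small [n] the compact interval may be empty or a single point, and the integral is then 0. *)
have [ab|ab] := ltP (a + n.+1%:R^-1) (b - n.+1%:R^-1); last first.
  rewrite (integral_Sset1 (a + n.+1%:R^-1)) ?lee_fin ?mulr_ge0// => x /=.
  rewrite in_itv/= => /andP[ax xb].
  by apply/le_anti; rewrite ax (le_trans xb).
have sub x : x \in `[a + n.+1%:R^-1, b - n.+1%:R^-1] -> x \in `]a, b[.
  exact: Eab.
have dcF x : x \in `[a + n.+1%:R^-1, b - n.+1%:R^-1] -> {for x, continuous F}.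
  move=> /sub /dF ?.
  by apply: differentiable_continuous; apply/derivable1_diffP; exact: ex_derive.
rewrite (continuous_FTC2 (F := F) ab).
+ rewrite -EFinB lee_fin mulr_natl mulr2n (le_trans (ler_norm _))//.
  rewrite (le_trans (ler_normB _ _))// lerD// (le_trans _ (ler_norm M))//.
    by rewrite FM// sub// in_itv/= lexx ltW.
  by rewrite FM// sub// in_itv/= lexx ltW.
+ apply: continuous_in_subspaceT => x; rewrite inE => /sub; exact: cf.
+ split.
  * move=> x /subset_itv_oo_cc /sub /dF ?; exact: ex_derive.
  * by apply: cvg_at_right_filter; apply: dcF; rewrite in_itv/= lexx ltW.
  * by apply: cvg_at_left_filter; apply: dcF; rewrite in_itv/= lexx ltW.
+ move=> x /subset_itv_oo_cc /sub /dF ?; rewrite derive1E; exact: derive_val.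
Qed.

Lemma continuous_powR (R : realType) (r x : R) :
  0 < x -> {for x, continuous (fun t => t `^ r)}.
Proof.
move=> x0; have dx := is_derive1_powR r x0.
apply: differentiable_continuous; apply/derivable1_diffP.
exact: ex_derive.
Qed.

Lemma powR_le1 {R : realType} {r x : R} : 0 <= r -> 0 < x <= 1 -> x `^ r <= 1.
Proof. by move=> r0 x01; rewrite -(powRr0 x) ger_powR. Qed.

Lemma powR_addr_onem_integrable {R : realType} {beta : R} : -1 < beta ->
  (@lebesgue_measure R).-integrable `]0, 1[
    (EFin \o (fun t => t `^ beta + (1 - t) `^ beta)).
Proof.
move=> beta1; have b1 : 0 < beta + 1 by lra.
pose F (t : R) : R := (beta + 1)^-1 * (t `^ (beta + 1) - (1 - t) `^ (beta + 1)).
apply: (@ge0_bounded_primitive_integrable _ _ F _ _ (beta + 1)^-1).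
- by move=> x _; rewrite addr_ge0 ?powR_ge0.
- move=> x; rewrite in_itv/= => /andP[x0 x1].
  apply: cvgD; first exact: continuous_powR.
  apply: (cvg_comp (fun t => 1 - t) (fun t => t `^ beta) (G := nbhs (1 - x))).
    by apply: cvgB; [exact: cvg_cst|exact: cvg_id].
  by apply: continuous_powR; rewrite subr_gt0.
- move=> x; rewrite in_itv/= => /andP[x0 x1].
  have x1' : 0 < 1 - x by rewrite subr_gt0.
  have dx := is_derive1_powR (beta + 1) x0.
  have dx' := is_derive1_powR (beta + 1) x1'.
  have d1 : is_derive x (1 : R) (fun t : R => 1 - t) (-1).
    by apply: is_derive_eq; rewrite add0r mul1r.
  have dc := @is_derive1_comp _ (fun t => t `^ (beta + 1)) (fun t : R => 1 - t)
    x _ _ dx' d1.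
  apply: is_derive_eq.
  by rewrite addrK mulrN1 opprK -mulrDr /GRing.scale/= mulKf// gt_eqF.
(* Since [beta + 1 > 0], both powers lie in [0, 1], so their difference is at most 1 in absolute
   value. *)
- move=> x; rewrite in_itv/= => /andP[x0 x1].
  rewrite /F normrM gtr0_norm ?invr_gt0// ler_piMr ?invr_ge0 ?(ltW b1)//.
  have x1' : 0 < 1 - x <= 1 by apply/andP; split; lra.
  have := powR_le1 (ltW b1) x1'; have := powR_ge0 (1 - x) (beta + 1).
  have x01 : 0 < x <= 1 by rewrite x0 ltW.
  have := powR_le1 (ltW b1) x01; have := powR_ge0 x (beta + 1).
  by rewrite ler_norml; lra.
Qed.

Lemma weight_integrable {R : realType} {beta : R} : -1 < beta ->
  (@lebesgue_measure R).-integrable `[0, 1] (EFin \o weight beta).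
Proof.
move=> beta1.
have mw : measurable_fun setT (weight beta).
  apply: measurable_funM; first exact: measurable_powR.
  apply: (measurableT_comp (measurable_powR beta)).
  exact: measurable_funB.
(* The endpoints form a null set, so the domination argument can be run on []0, 1[], where the
   dominating function is known to be integrable. *)
have m01 : measurable ([set 0; 1] : set R).
  by apply: measurableU; exact: measurable_set1.
have := @negligible_integrable _ _ _ (@lebesgue_measure R) `[0, 1]%classic _
  (EFin \o weight beta) m01.
case=> [//|||_].
- by apply/measurable_EFinP; exact: measurable_funS mw.
- apply: countable_lebesgue_measure0; apply: finite_set_countable.
  exact: finite_set2.
apply; rewrite setDitv_set2.
move: (powR_addr_onem_integrable beta1); apply: le_integrable => //.
  by apply/measurable_EFinP; exact: measurable_funS mw.
move=> x /=; rewrite in_itv/= => /andP[x0 x1].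
rewrite lee_fin !ger0_norm ?addr_ge0 ?mulr_ge0 ?powR_ge0//.
have b1 : 0 < beta + 1 by lra.
have powM (y : R) : 0 < y <= 1 -> y * y `^ beta <= 1.
  move=> /[dup] y01 /andP[/ltW y0 _].
  (* Reading [beta] as [(beta + 1) - 1] turns the product into a power of exponent [beta + 1]. *)
  by rewrite -(addrK 1 beta) mulr_powRB1// powR_le1// ltW.
(* Multiplying by [1 = x + (1 - x)] splits the weight into two terms, each with
   a factor of exponent [beta + 1 > 0], which is at most 1. *)
have -> : weight beta x = x * x `^ beta * (1 - x) `^ beta +
    (1 - x) * (1 - x) `^ beta * x `^ beta.
  by rewrite /weight; lra.
rewrite addrC lerD// ler_piMl ?powR_ge0// powM//; apply/andP; split; lra.
Qed.

(** * Quadratic polynomials on segments of the triangle *)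

Lemma P2_lincomb (R : realType) (v : 'I_3 -> 'rV[R]_2) (I : finType)
    (c : I -> R) (g : I -> 'rV[R]_2 -> R) :
  (forall i, P2 v (g i)) -> P2 v (fun x => \sum_i c i * g i x).
Proof.
move=> P2g; have [P gP] := choice P2g.
exists (\sum_i c i *: P i); split => [|x vx].
  apply: leq_trans (msize_sum _ _ _) _.
  apply/bigmax_leqP => i _.
  by apply: leq_trans (msizeZ_le _ _) _; have [] := gP i.
rewrite raddf_sum; apply: eq_bigr => i _.
by rewrite /= mevalZ; have [_ ->] := gP i.
Qed.

Lemma triangle_segment (R : realType) (v : 'I_3 -> 'rV[R]_2)
    (a b : 'rV[R]_2) (t : R) :
  triangle v a -> triangle v b -> 0 <= t <= 1 ->
  triangle v (t *: a + (1 - t) *: b).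
Proof.
move=> [ca [ca0 ca1 ->]] [cb [cb0 cb1 ->]] /andP[t0 t1].
exists (fun i => t * ca i + (1 - t) * cb i); split.
- by move=> i; rewrite addr_ge0// mulr_ge0// subr_ge0.
- by rewrite big_split/= -!mulr_sumr ca1 cb1; lra.
- rewrite !scaler_sumr -big_split/=.
  by apply: eq_bigr => i _; rewrite !scalerA scalerDl.
Qed.

Lemma triangle_vertex (R : realType) (v : 'I_3 -> 'rV[R]_2) (j : 'I_3) :
  triangle v (v j).
Proof.
exists (fun i => (i == j)%:R); split => [i||]; first exact: ler0n.
- by rewrite (bigD1 j)//= eqxx big1 ?addr0 // => i /negPf ->.
- rewrite (bigD1 j)//= eqxx scale1r big1 ?addr0// => i /negPf ->.
  exact: scale0r.
Qed.

Lemma triangle_barycenter (R : realType) (v : 'I_3 -> 'rV[R]_2) :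
  triangle v (barycenter v).
Proof.
exists (fun=> 3%:R^-1); split => [i||]; first by rewrite invr_ge0.
- by rewrite sumr_const card_ord -[LHS]mulr_natl mulfV ?pnatr_eq0.
- by rewrite /barycenter scaler_sumr.
Qed.

(** The coordinates are affine in [t] along a segment; substituting them into [P] monomial by
    monomial gives a univariate polynomial [Q]. *)
Lemma continuous_meval_segment (R : realType) (P : mpoly 2 R)
    (a b : 'rV[R]_2) :
  continuous (fun t : R => meval (fun i => (t *: a + (1 - t) *: b) 0 i) P).
Proof.
pose Q := \sum_(m <- msupp P) mcoeff m P *:
  \prod_i ((a 0 i - b 0 i) *: 'X + (b 0 i)%:P) ^+ m i.
rewrite (_ : (fun t => _) = horner Q); first exact: continuous_horner.
apply/funext => t; rewrite mevalE /Q horner_sum; apply: eq_bigr => m _.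
rewrite hornerZ horner_prod; congr (_ * _); apply: eq_bigr => i _.
by rewrite !hornerE !mxE; congr (_ ^+ _); lra.
Qed.

(** An integrable weight times a bounded measurable factor is integrable. The factor used is the
    polynomial behind [p], continuous in [t] on the whole line and hence bounded on [0, 1]; [p]
    itself is controlled only on the triangle. *)
Lemma weighted_segment_integrable {R : realType} {v : 'I_3 -> 'rV[R]_2}
    {w : R -> R} {a b : 'rV[R]_2} {p : 'rV[R]_2 -> R} :
  (@lebesgue_measure R).-integrable `[0, 1] (EFin \o w) ->
  triangle v a -> triangle v b -> P2 v p ->
  (@lebesgue_measure R).-integrable `[0, 1]
    (EFin \o (fun t => w t * p (t *: a + (1 - t) *: b))).
Proof.
move=> iw va vb [P [_ pP]].
pose h t := meval (fun i => (t *: a + (1 - t) *: b) 0 i) P.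
have ch : continuous h by exact: continuous_meval_segment.
have : (@lebesgue_measure R).-integrable `[0, 1]
    ((EFin \o w) \* (EFin \o h))%E.
  apply: integrableMl => //.
    by apply: measurable_funTS; exact: continuous_measurable_fun.
  have /compact_bounded[M [Mr hM]] : compact (h @` `[0, 1]%classic).
    apply: continuous_compact; first exact: continuous_subspaceT.
    exact: segment_compact.
  by exists M; split => // N MN x x01; apply: hM => //; exists x.
apply: eq_integrable => // t; rewrite inE/= in_itv/= => t01.
by rewrite pP//; exact: triangle_segment.
Qed.

(** * Linearity and locality of the functionals *)

Lemma Rintegral_sum d (T : measurableType d) (R : realType)
    (mu : {measure set T -> \bar R}) (D : set T) (I : Type) (s : seq I)
    (f : I -> T -> R) :
  measurable D -> (forall i, mu.-integrable D (EFin \o f i)) ->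
  \int[mu]_(x in D) (\sum_(i <- s) f i x) =
  \sum_(i <- s) \int[mu]_(x in D) f i x.
Proof.
move=> mD fi; elim: s => [|i s IHs].
  rewrite big_nil; under eq_Rintegral do rewrite big_nil.
  by rewrite Rintegral_cst// mul0r.
rewrite big_cons -IHs; under eq_Rintegral do rewrite big_cons.
rewrite RintegralD//.
rewrite (_ : EFin \o _ = fun x => (\sum_(i <- s) (f i x)%:E)%E).
  by apply: integrable_sum => // k _; exact: fi.
by apply/funext => x /=; rewrite sumEFin.
Qed.

(** The weight is left general to serve both families: it is 1 on the edges for [ICR], and
    [weight beta] on the segments from a vertex to the barycenter for [Genr]. *)
Lemma weighted_segment_lincomb {R : realType} {v : 'I_3 -> 'rV[R]_2}
    {w : R -> R} {a b : 'rV[R]_2} {I : finType} (c : I -> R)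
    {g : I -> 'rV[R]_2 -> R} :
  (@lebesgue_measure R).-integrable `[0, 1] (EFin \o w) ->
  triangle v a -> triangle v b -> (forall i, P2 v (g i)) ->
  \int[@lebesgue_measure R]_(t in `[0, 1])
      (w t * \sum_i c i * g i (t *: a + (1 - t) *: b)) =
  \sum_i c i * \int[@lebesgue_measure R]_(t in `[0, 1])
      (w t * g i (t *: a + (1 - t) *: b)).
Proof.
move=> iw va vb P2g.
have ig i := weighted_segment_integrable iw va vb (P2g i).
rewrite (_ : (fun t => _) = (fun t => \sum_i c i *
    (w t * g i (t *: a + (1 - t) *: b)))); last first.
  apply/funext => t; rewrite mulr_sumr; apply: eq_bigr => i _.
  exact: mulrCA.
rewrite Rintegral_sum//.
  by apply: eq_bigr => i _; rewrite RintegralZl.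
by move=> i; exact: (integrableZl _ (c i) (ig i)).
Qed.

Lemma ICR_lincomb (R : realType) (v : 'I_3 -> 'rV[R]_2) (j : 'I_3)
    (I : finType) (c : I -> R) (g : I -> 'rV[R]_2 -> R) :
  (forall i, P2 v (g i)) ->
  ICR v j (fun x => \sum_i c i * g i x) = \sum_i c i * ICR v j (g i).
Proof.
move=> P2g; have icst : (@lebesgue_measure R).-integrable `[0, 1]
    (EFin \o cst 1).
  apply: continuous_compact_integrable; first exact: segment_compact.
  by apply: continuous_subspaceT; exact: cst_continuous.
have ICRE f : ICR v j f = \int[@lebesgue_measure R]_(t in `[0, 1])
    (cst 1 t * f (t *: v (j + 1) + (1 - t) *: v (j + 2%:R))).
  by apply: eq_Rintegral => t _; rewrite mul1r.
rewrite ICRE (weighted_segment_lincomb _ icst (triangle_vertex _ _ _)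
  (triangle_vertex _ _ _) P2g).
by apply: eq_bigr => i _; rewrite ICRE.
Qed.

Lemma Genr_lincomb (R : realType) (v : 'I_3 -> 'rV[R]_2) (beta : R) (j : 'I_3)
    (I : finType) (c : I -> R) (g : I -> 'rV[R]_2 -> R) :
  -1 < beta -> (forall i, P2 v (g i)) ->
  Genr v beta j (fun x => \sum_i c i * g i x) =
  \sum_i c i * Genr v beta j (g i).
Proof.
move=> beta1 P2g; exact: (weighted_segment_lincomb c (weight_integrable beta1)
  (triangle_vertex _ _ _) (triangle_barycenter _ _) P2g).
Qed.

(** Expansions in the basis hold only on the triangle; this allows a polynomial to be replaced by
    its expansion under the functional. *)
Lemma eq_ICR (R : realType) (v : 'I_3 -> 'rV[R]_2) (j : 'I_3)
    (f g : 'rV[R]_2 -> R) :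
  (forall x, triangle v x -> f x = g x) -> ICR v j f = ICR v j g.
Proof.
move=> fg; apply: eq_Rintegral => t; rewrite inE/= in_itv/= => t01.
by apply/fg/triangle_segment => //; exact: triangle_vertex.
Qed.

Lemma eq_Genr (R : realType) (v : 'I_3 -> 'rV[R]_2) (beta : R) (j : 'I_3)
    (f g : 'rV[R]_2 -> R) :
  (forall x, triangle v x -> f x = g x) -> Genr v beta j f = Genr v beta j g.
Proof.
move=> fg; apply: eq_Rintegral => t; rewrite inE/= in_itv/= => t01.
rewrite fg//; apply: triangle_segment => //; first exact: triangle_vertex.
exact: triangle_barycenter.
Qed.

(** * Duality between functionals and basis *)

Section BasisFunctions.
Context (R : realType) (v : 'I_3 -> 'rV[R]_2) (beta : R) (beta_gt : -1 < beta)
  (tau rho : 'I_3 -> 'rV[R]_2 -> R)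
  (tau_rho_basis : basis_functions v beta tau rho).

Let basis (k : 'I_3 + 'I_3) : 'rV[R]_2 -> R :=
  match k with inl i => tau i | inr i => rho i end.

Let P2_basis k : P2 v (basis k).
Proof. by have [[P2tr _ _] _ _ _ _] := tau_rho_basis; exact: (P2tr k). Qed.

(** By duality the [rho] terms vanish and only the [tau j] term survives, so the functional reads
    off a coefficient. *)
Lemma ICR_basis_lincomb (c : 'I_3 + 'I_3 -> R) (j : 'I_3) :
  ICR v j (fun x => \sum_k c k * basis k x) = c (inl j).
Proof.
have [_ It _ Ir _] := tau_rho_basis.
rewrite ICR_lincomb// big_sumType/= [X in _ + X]big1 ?addr0 => [|i _].
  rewrite (bigD1 j)//= It eqxx mulr1 big1 ?addr0// => i /negPf ij.
  by rewrite It ij mulr0.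
by rewrite Ir mulr0.
Qed.

Lemma Genr_basis_lincomb (c : 'I_3 + 'I_3 -> R) (j : 'I_3) :
  Genr v beta j (fun x => \sum_k c k * basis k x) = c (inr j).
Proof.
have [_ _ Gt _ Gr] := tau_rho_basis.
rewrite Genr_lincomb// big_sumType/= big1 ?add0r => [|i _].
  rewrite (bigD1 j)//= Gr eqxx mulr1 big1 ?addr0// => i /negPf ij.
  by rewrite Gr ij mulr0.
by rewrite Gt mulr0.
Qed.

(** A single sum over the disjoint union of the two index sets makes the coefficient lemmas
    applicable to the operator. *)
Lemma Pi_enrE (f : 'rV[R]_2 -> R) :
  Pi_enr v beta tau rho f = fun x => \sum_k
    match k with inl j => ICR v j f | inr j => Genr v beta j f end * basis k x.
Proof. by apply/funext => x; rewrite big_sumType/= -big_split. Qed.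

End BasisFunctions.

Theorem theorem3p6 (R : realType) (v : 'I_3 -> 'rV[R]_2)
    (v_nondegenerate : nondegenerate_triangle v)
    (beta : R) (beta_gt : -1 < beta)
    (tau rho : 'I_3 -> 'rV[R]_2 -> R)
    (tau_rho_basis : basis_functions v beta tau rho) :
  [/\ forall f : 'rV[R]_2 -> R, CT v f -> P2 v (Pi_enr v beta tau rho f),
      forall p : 'rV[R]_2 -> R, P2 v p ->
        forall x, triangle v x -> Pi_enr v beta tau rho p x = p x
    & forall f : 'rV[R]_2 -> R, CT v f -> forall j : 'I_3,
        ICR v j (Pi_enr v beta tau rho f) = ICR v j f /\
        Genr v beta j (Pi_enr v beta tau rho f) = Genr v beta j f].
Proof.
have [[P2tr _ span] _ _ _ _] := tau_rho_basis.
split => [f _|p P2p x vx|f _ j].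
- by rewrite Pi_enrE; exact: P2_lincomb.
(* Reproduction: applying each functional to the expansion of [p] identifies the coefficients [a]
   with those of the operator. *)
- have [a pa] := span p P2p.
  rewrite Pi_enrE pa//; apply: eq_bigr => -[] j _; congr (_ * _).
    rewrite (eq_ICR _ _ _ _ _ pa).
    by rewrite (ICR_basis_lincomb _ _ _ _ _ tau_rho_basis).
  rewrite (eq_Genr _ _ _ _ _ _ pa).
  by rewrite (Genr_basis_lincomb _ _ _ beta_gt _ _ tau_rho_basis).
(* The coefficients read off here are, by construction, the functionals of [f]. *)
- rewrite Pi_enrE (ICR_basis_lincomb _ _ _ _ _ tau_rho_basis).
  by rewrite (Genr_basis_lincomb _ _ _ beta_gt _ _ tau_rho_basis).
Qed.
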